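(* Let $s,t,r$ be positive integers with $r\ge s$. An SBP operator with parameters $(s,t,r)$ and diagonal $P$ exists if and only if there is a diagonal positive definite matrix $\tilde P\in\mathbb{R}^{r\times r}$ satisfying $$\sum_{k=0}^{r-1}(p+q)\,k^{p+q-1}\,\tilde P_{kk}=\sum_{k=0}^{r-1}\sum_{\ell=0}^{s-1}\left(k^p(r+\ell)^q+k^q(r+\ell)^p\right)C_{k\ell}-\delta_{p0}\delta_{q0}$$ for every $p=0,1,\ldots,t$ and $q=p,p+1,\ldots,t$.
   Context: All vectors and matrices are indexed starting from $0$. Conventions: $0^0=1$, and any term of the form $j\,x^{j-1}$ with $j=0$ equals $0$ (also when $x=0$). $\delta$ is the Kronecker delta. Centered stencil: $\alpha_1,\dots,\alpha_s$ are the coefficients of the standard centered finite difference approximation of the first derivative of order $2s$ with unit step, $f'(x)\approx\sum_{j=1}^s\alpha_j\,(f(x+j)-f(x-j))$; explicitly $\alpha_j=\dfrac{(-1)^{j+1}(s!)^2}{j\,(s-j)!\,(s+j)!}$. The matrix $C\in\mathbb{R}^{r\times s}$ is defined by $C_{k\ell}=\alpha_{r+\ell-k}$ if $1\le r+\ell-k\le s$ and $C_{k\ell}=0$ otherwise ($0\le k\le r-1$, $0\le\ell\le s-1$). SBP operator with parameters $(s,t,r)$ (unit step size) on $n\ge 2r+s$ grid points $0,1,\dots,n-1$: a pair of matrices $P,D\in\mathbb{R}^{n\times n}$ such that (1) $P=\mathrm{diag}(\tilde P,I_{n-2r},\hat P)$ is block diagonal with $\tilde P,\hat P\in\mathbb{R}^{r\times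 r}$ symmetric positive definite (the phrase ''diagonal $P$'' means that $\tilde P$ and $\hat P$ are moreover diagonal matrices). (2) For each interior row $i=r,\dots,n-r-1$: $D_{i,i+j}=\alpha_j$ and $D_{i,i-j}=-\alpha_j$ for $1\le j\le s$, and all other entries of row $i$ are $0$. (3) The first $r$ and last $r$ rows of $D$ are finite difference approximations of the first derivative of order $t$: for each such row $i$ and each $m=0,1,\dots,t$, $\sum_{j=0}^{n-1}D_{ij}\,j^m=m\,i^{m-1}$. (4) The energy condition $PD+D^TP=e_{n-1}e_{n-1}^T-e_0e_0^T$ holds, where $e_0,\dots,e_{n-1}$ is the canonical basis of $\mathbb{R}^n$. (5) $D$ has the form $$D=\begin{bmatrix}\tilde P^{-1}&0&0\\0&I&0\\0&0&\hat P^{-1}\end{bmatrix}\begin{bmatrix}B&C_0&0\\-C_0^T&\tilde D&-\hat C_0^T\\0&\hat C_0&\hat B\end{bmatrix}$$ with $B,\hat B\in\mathbb{R}^{r\times r}$, $C_0=[\,C\;\;0\,]$ and $\hat C_0=[\,0\;\;\hat C\,]$ in $\mathbb{R}^{r\times(n-2r)}$, where $\hat C\in\mathbb{R}^{r\times s}$ (the blocks $C_0,\tilde D,\hat C_0$ are determined by the interior rows in (2)). We say an SBP operator with parameters $(s,t,r)$ and diagonal $P$ exists if such a pair with diagonal $P$ exists for every $n\ge 2r+s$. *)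

(* Defs.v *)
From mathcomp Require Import all_boot all_order all_algebra.
From mathcomp Require Import reals.

Set Implicit Arguments.
Unset Strict Implicit.
Unset Printing Implicit Defensive.

Import Order.TTheory GRing.Theory Num.Theory.
Local Open Scope ring_scope.

(* The powers x ^+ 0 are 1 also for x = 0, and the derivative m x^(m-1) of x^m
   is written m%:R * x ^+ m.-1, which is 0 for m = 0. *)

Section SBP.
Variable R : realType.

Definition posdefmx r (A : 'M[R]_r) : Prop :=
  A^T = A /\ forall x : 'cV[R]_r, x != 0 -> 0 < (x^T *m A *m x) 0 0.

(* Coefficients of the centered difference of order 2s,
   f'(x) ~ \sum_(1 <= j <= s) alpha s j * (f (x + j) - f (x - j));
   only meaningful for 1 <= j <= s. *)
Definition alpha (s j : nat) : R :=
  (-1) ^+ j.+1 * (s`!)%:R ^+ 2 / (j%:R * ((s - j)`!)%:R * ((s + j)`!)%:R).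

Definition Cmx (s r : nat) : 'M[R]_(r, s) :=
  \matrix_(k < r, l < s)
    if (1 <= r + l - k <= s)%N then alpha s (r + l - k) else 0.

Definition stencil (s i j : nat) : R :=
  if (i < j <= i + s)%N then alpha s (j - i)
  else if (j < i <= j + s)%N then - alpha s (i - j)
  else 0.

Definition diag3_mx r m (A : 'M[R]_r) (M : 'M[R]_m) (Z : 'M[R]_r) :
    'M[R]_(r + (m + r)) :=
  block_mx A 0 0 (block_mx M 0 0 Z).

(* [C 0] and [0 C] in width m; the default value 0 of conform_mx is used only
   when m < s, which is excluded wherever these are applied. *)
Definition padr_mx m r s (C : 'M[R]_(r, s)) : 'M[R]_(r, m) :=
  conform_mx 0 (row_mx C (0 : 'M[R]_(r, m - s))).
Definition padl_mx m r s (C : 'M[R]_(r, s)) : 'M[R]_(r, m) :=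
  conform_mx 0 (row_mx (0 : 'M[R]_(r, m - s)) C).

Definition evec (n k : nat) : 'cV[R]_n := \col_(i < n) (i == k :> nat)%:R.

(* The grid has r + (m + r) points, m of them interior. *)
Record sbp_operator (s t r m : nat) (Pt Ph : 'M[R]_r)
    (P D : 'M[R]_(r + (m + r))) : Prop := SbpOperator {
  sbp_Pt_posdef : posdefmx Pt;
  sbp_Ph_posdef : posdefmx Ph;
  sbp_P_blocks : P = diag3_mx Pt 1%:M Ph;
  sbp_interior : forall i j : 'I_(r + (m + r)),
    (r <= i < r + m)%N -> D i j = stencil s i j;
  sbp_accuracy : forall (i : 'I_(r + (m + r))) (k : nat),
    (i < r)%N || (r + m <= i)%N -> (k <= t)%N ->
    \sum_(j < r + (m + r)) D i j * j%:R ^+ k = k%:R * i%:R ^+ k.-1;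
  sbp_energy :
    let e := evec (r + (m + r)) in
    let last := (r + (m + r)).-1 in
    P *m D + D^T *m P = e last *m (e last)^T - e 0 *m (e 0)^T;
  sbp_D_blocks : exists (B Bh : 'M[R]_r) (Dt : 'M[R]_m) (Ch : 'M[R]_(r, s)),
    let C0 := padr_mx m (Cmx s r) in
    let Ch0 := padl_mx m Ch in
    D = diag3_mx (invmx Pt) 1%:M (invmx Ph) *m
        block_mx B                   (row_mx C0 0)
                 (col_mx (- C0^T) 0) (block_mx Dt  (- Ch0^T)
                                               Ch0 Bh)
}.

(* On n >= 2 r + s points there are n - 2 r interior points, so the matrices
   below have size r + ((n - 2 r) + r) = n. *)
Definition diagonal_sbp_exists (s t r : nat) : Prop :=
  forall n : nat, (2 * r + s <= n)%N ->
  exists (Pt Ph : 'M[R]_r) (P D : 'M[R]_(r + ((n - 2 * r) + r))),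
    [/\ is_diag_mx Pt, is_diag_mx Ph & sbp_operator s t Pt Ph P D].

End SBP.

(* Main.v *)
Require Import Defs.
From mathcomp Require Import all_boot all_order all_algebra.
From mathcomp Require Import reals.
From mathcomp Require Import ring zify.
Set Implicit Arguments.
Unset Strict Implicit.
Unset Printing Implicit Defensive.
Import Order.TTheory GRing.Theory Num.Theory.
Local Open Scope ring_scope.

(** Multiply the first r rows of D by P. The energy condition then says that
    the boundary block B has symmetric part fixed, B + B^T = - e_0 e_0^T, and
    the accuracy of these rows says that B sends the monomial vectors
    x_p = (0^p, .., (r-1)^p), p <= t, to the vectors
    g_p = P (p k^(p-1))_k - C ((r+l)^p)_l. Pairing B x_p with x_q and
    symmetrizing eliminates B and leaves the displayed equations.

    Conversely these equations say exactly that the required values g_p are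
    compatible with the required symmetric part. A matrix B with these data
    then exists ([prescribed_symmetric_part]): this is clear if the x_p are
    linearly independent, and it is also true if they span, since then the
    pairing with all x_q determines a vector, so every linear relation between
    the x_p holds between the values too. Vectors x_0, .., x_t always fall
    under one of the two cases, by Vandermonde. Thus both sides of the theorem
    amount to the existence of B ([quadrature_conditionsP]).

    From B, which does not depend on n, an operator on n points is obtained by
    taking the skew-symmetric banded matrix of the stencil, replacing its
    upper corner by B and its lower corner by the reflection of - B, and
    dividing the rows by the diagonal of P, where the last block of P is the
    reflection of the first. Reversing the grid changes the sign of the matrix;
    since exactness on monomials of degree at most t is exactness on all
    polynomials of degree at most t, in particular on (N - x)^p, the accuracy
    of the last rows follows from that of the first
    ([reflected_closure_exact]). *)

(** * Matrices with prescribed symmetric part and prescribed values *)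

Section Interpolation.
Variable F : fieldType.

Lemma Vandermonde_unit n (a : 'rV[F]_n) :
  injective (a 0) -> Vandermonde n a \in unitmx.
Proof.
move=> a_inj; rewrite unitmxE det_Vandermonde unitfE.
apply/prodf_neq0 => i _; apply/prodf_neq0 => j ij.
by rewrite subr_eq0 (inj_eq a_inj) -val_eqE gtn_eqF.
Qed.

(** Any min(m, n) nodes give an invertible square Vandermonde submatrix. *)
Lemma Vandermonde_free_or_full m n (a : 'rV[F]_n) : injective (a 0) ->
  row_free (Vandermonde m a) || row_full (Vandermonde m a).
Proof.
move=> a_inj; case: (leqP m n) => [le_mn | /ltnW le_nm]; apply/orP.
- left; pose f := widen_ord le_mn.
  have f_inj : injective f by move=> i j [] /val_inj.
  pose U := Vandermonde m (\row_i a 0 (f i)).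
  have Uu : U \in unitmx.
    by apply: Vandermonde_unit => i j; rewrite !mxE => /a_inj /f_inj.
  apply/row_freeP; exists (colsub f 1%:M *m invmx U).
  rewrite mulmxA mulmx_colsub mulmx1 -[RHS](mulmxV Uu); congr (_ *m _).
  by apply/matrixP => i j; rewrite !mxE.
- right; pose f := widen_ord le_nm.
  have Vu := Vandermonde_unit a_inj.
  apply/row_fullP; exists (invmx (Vandermonde n a) *m rowsub f 1%:M).
  rewrite -mulmxA -rowsubE -[RHS](mulVmx Vu); congr (_ *m _).
  by apply/matrixP => i j; rewrite !mxE.
Qed.

(** The hypothesis on H *m X^T is necessary, since H *m X^T = X *m S *m X^T.
    The rank hypothesis is what makes the columns of H lie in the column space
    of X: if X only has full column rank, this follows from skew-symmetry,
    because H *m X^T = - X *m H^T has its columns there and X^T can be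
    cancelled. *)
Lemma skew_interpolation m n (X H : 'M[F]_(m, n)) :
    row_free X || row_full X -> (H *m X^T)^T = - (H *m X^T) ->
  exists2 S : 'M[F]_n, S^T = - S & X *m S = H.
Proof.
set A := H *m X^T => freeX skewA.
have XH : X *m H^T = - A by rewrite -skewA trmx_mul trmxK.
pose Y := pinvmx X; have XYX : X *m Y *m X = X by rewrite mulmxKpV.
have XYH : X *m Y *m H = H.
  case/orP: freeX => [freeX | fullX]; first by rewrite mulmxVp // mul1mx.
  have freeXT : row_free X^T by rewrite /row_free mxrank_tr.
  apply: (row_free_inj freeXT); rewrite /= -/A -mulmxA -/A.
  by rewrite -[A]opprK -XH mulmxN mulmxA XYX.
have XYA : X *m Y *m A = A by rewrite [LHS]mulmxA XYH.
(* For the skew part of Y *m H alone, X *m (Y *m H - (Y *m H)^T) exceeds H by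
   A *m Y^T; the skew matrix Y *m A *m Y^T removes this excess. *)
clearbody A Y; exists (Y *m H - (Y *m H)^T - Y *m A *m Y^T).
  rewrite !linearB /= trmxK (trmx_mul (Y *m A)) (trmx_mul Y A) trmxK skewA.
  by rewrite mulNmx mulmxN mulmxA !opprK; congr (_ + _); rewrite addrC.
rewrite trmx_mul !mulmxBr !mulmxA XYH XH XYA.
by rewrite mulNmx opprK addrK.
Qed.

End Interpolation.

(** The symmetric part of B has to be E / 2, so that only its skew part is left
    to find. The compatibility condition arises from pairing the rows of
    X *m B^T = G with those of X and adding the transpose. *)
Lemma prescribed_symmetric_part (F : numFieldType) m n (X G : 'M[F]_(m, n))
    (E : 'M[F]_n) :
    row_free X || row_full X -> E^T = E ->
    X *m G^T + G *m X^T = X *m E *m X^T ->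
  exists2 B : 'M[F]_n, B + B^T = E & X *m B^T = G.
Proof.
move=> freeX symE XG; pose Z : 'M[F]_n := 2^-1 *: E.
have ZZ : Z + Z = E.
  by rewrite -scalerDl -mulr2n -(mulr_natl 2^-1) divff ?pnatr_eq0 ?scale1r.
have symZ : Z^T = Z by rewrite /Z linearZ /= symE.
have [|S skewS XS] := @skew_interpolation F m n X (G - X *m Z) freeX.
  rewrite mulmxBl linearB /= !trmx_mul trmxK symZ mulmxA.
  move/eqP: XG; rewrite -ZZ mulmxDr mulmxDl => /eqP XG.
  by apply/eqP; rewrite opprB subr_eq addrAC -XG addrK.
exists (Z - S).
  by rewrite linearB /= symZ skewS opprK addrACA addNr addr0.
by rewrite linearB /= symZ skewS opprK mulmxDr XS addrC subrK.
Qed.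

(** * The boundary block and the quadrature conditions *)

Section SBP.
Variable R : realType.

(** Accuracy of order t of the first r rows, multiplied by the diagonal matrix
    of the w k; the columns beyond r + s do not contribute. *)
Definition closure_exact s t r (B : 'M[R]_r) (w : 'I_r -> R) : Prop :=
  forall (k : 'I_r) (p : nat), (p <= t)%N ->
    \sum_(j < r) B k j * j%:R ^+ p + \sum_(l < s) Cmx R s r k l * (r + l)%:R ^+ p
    = w k * (p%:R * k%:R ^+ p.-1).

Definition quadrature_conditions s t r (w : 'I_r -> R) : Prop :=
  forall p q : nat, (p <= t)%N -> (p <= q <= t)%N ->
    \sum_(k < r) (p + q)%:R * k%:R ^+ (p + q).-1 * w k =
    \sum_(k < r) \sum_(l < s)
      (k%:R ^+ p * (r + l)%:R ^+ q + k%:R ^+ q * (r + l)%:R ^+ p)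
      * Cmx R s r k l
    - (p == 0%N)%:R * (q == 0%N)%:R.

(** The product rule for x^p x^q, with the convention that p x^(p-1) is 0 for
    p = 0 even if x = 0. *)
Lemma deriv_mul_pow (x : R) p q :
  x ^+ p * (q%:R * x ^+ q.-1) + p%:R * x ^+ p.-1 * x ^+ q =
  (p + q)%:R * x ^+ (p + q).-1.
Proof.
case: p q => [|p] [|q]; rewrite ?(mul0r, mulr0, addr0, add0r, expr0, mul1r,
  mulr1, addn0, add0n) //=.
rewrite natrD addnS !exprS exprD; ring.
Qed.

(** In terms of the Vandermonde matrix X of the nodes 0, .., r-1, exactness is
    X *m B^T = G for an explicit G, and the (p, q) entry of the compatibility
    condition of [prescribed_symmetric_part] is the quadrature condition for
    p and q. The term with the Kronecker deltas is the contribution of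
    e_0 e_0^T, as the monomial x^p takes the value 0^p at the node 0. *)
Lemma quadrature_conditionsP s t r (w : 'I_r -> R) : (0 < r)%N ->
  quadrature_conditions s t w <->
  exists2 B : 'M[R]_r, B + B^T = - (evec R r 0 *m (evec R r 0)^T) &
    closure_exact s t B w.
Proof.
move=> r_gt0; set E := - _.
pose X := Vandermonde t.+1 (\row_(j < r) j%:R : 'rV[R]_r).
pose G : 'M[R]_(t.+1, r) := \matrix_(p, k)
  (w k * (p%:R * k%:R ^+ p.-1) - \sum_(l < s) Cmx R s r k l * (r + l)%:R ^+ p).
have closureE B : closure_exact s t B w <-> X *m B^T = G.
  split=> [exB | /matrixP XB k p le_pt].
    apply/matrixP => p k; rewrite !mxE -exB -1?ltnS // addrK.
    by apply: eq_bigr => j _; rewrite !mxE mulrC.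
  have /= := XB (inord p) k; rewrite !mxE inordK // => /eqP.
  rewrite eq_sym subr_eq => /eqP ->; congr (_ + _).
  by apply: eq_bigr => j _; rewrite !mxE inordK // mulrC.
have symE : E^T = E by rewrite /E linearN /= trmx_mul trmxK.
have XEX p q : (X *m E *m X^T) p q =
    - ((p == 0%N :> nat)%:R * (q == 0%N :> nat)%:R).
  have X0 i : (X *m evec R r 0) i 0 = (i == 0%N :> nat)%:R.
    rewrite mxE (bigD1 (Ordinal r_gt0)) //= big1 => [|j].
      by rewrite !mxE /= mulr1 addr0 expr0n.
    by rewrite -val_eqE !mxE /= => /negPf ->; rewrite mulr0.
  rewrite /E mulmxN mulNmx mulmxA -mulmxA -trmx_mul mxE; congr (- _).
  by rewrite mxE big_ord1 -X0 -X0; congr (_ * _); rewrite [LHS]mxE.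
have XGE p q : (X *m G^T + G *m X^T) p q =
    \sum_(k < r) (p + q)%:R * k%:R ^+ (p + q).-1 * w k -
    \sum_(k < r) \sum_(l < s)
      (k%:R ^+ p * (r + l)%:R ^+ q + k%:R ^+ q * (r + l)%:R ^+ p)
      * Cmx R s r k l.
  rewrite !mxE -big_split -sumrB; apply: eq_bigr => k _; rewrite !mxE.
  rewrite -deriv_mul_pow.
  under [in RHS]eq_bigr => l _ do rewrite mulrDl -!mulrA
    ![_ ^+ _ * Cmx R s r k l]mulrC.
  rewrite big_split -!mulr_sumr /=; ring.
split=> [quad | [B symB /closureE XB] p q le_pt /andP[le_pq le_qt]].
  have freeX : row_free X || row_full X.
    apply: Vandermonde_free_or_full => i j; rewrite !mxE => /eqP.
    by rewrite eqr_nat => /eqP /val_inj.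
  have compat : X *m G^T + G *m X^T = X *m E *m X^T.
    apply/matrixP => p q; wlog le_pq : p q / (p <= q)%N => [hw|].
      have symm (M : 'M[R]_t.+1) : M^T = M -> M p q = M q p.
        by move=> {1}<-; rewrite mxE.
      case/orP: (leq_total p q) => [/hw // | /hw hqp].
      rewrite symm ?[RHS]symm //.
        by rewrite !trmx_mul trmxK symE mulmxA.
      by rewrite linearD /= !trmx_mul !trmxK addrC.
    rewrite XGE XEX quad ?le_pq ?leq_ord //.
    by rewrite addrAC subrr add0r.
  have [B symB XB] := prescribed_symmetric_part freeX symE compat.
  by exists B => //; apply/closureE.
have := XGE (inord p) (inord q); rewrite !inordK // -XB trmx_mul trmxK.
have -> : X *m (B *m X^T) + X *m B^T *m X^T = X *m E *m X^T.
  by rewrite mulmxA -mulmxDl -mulmxDr symB.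
by rewrite XEX !inordK // => /eqP; rewrite eq_sym subr_eq addrC => /eqP.
Qed.

(** * The interior stencil *)

Lemma stencil_diff s i j k l :
  (i + l = k + j)%N -> stencil R s i j = stencil R s k l.
Proof.
move=> e; rewrite /stencil.
have -> : (i < j <= i + s)%N = (k < l <= k + s)%N by lia.
have -> : (j < i <= j + s)%N = (l < k <= l + s)%N by lia.
by have [-> ->] : (j - i = l - k /\ i - j = k - l)%N by lia.
Qed.

Lemma stencil_skew s i j : stencil R s i j = - stencil R s j i.
Proof.
rewrite /stencil; case: (ltngtP i j) => [lt_ij|lt_ji|->] /=; last by rewrite oppr0.
  by case: ifP; rewrite ?opprK ?oppr0.
by case: ifP => //; rewrite oppr0.
Qed.

Lemma stencil_far s i j : (i + s < j)%N || (j + s < i)%N -> stencil R s i j = 0.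
Proof.
move=> far; rewrite /stencil.
have -> : (i < j <= i + s)%N = false by lia.
by have -> : (j < i <= j + s)%N = false by lia.
Qed.

Lemma Cmx_stencil s r (k : 'I_r) (l : 'I_s) : Cmx R s r k l = stencil R s k (r + l).
Proof.
rewrite mxE /stencil; have lt_kr := ltn_ord k.
have -> : (k < r + l <= k + s)%N = (1 <= r + l - k <= s)%N by lia.
by have -> : (r + l < k <= r + l + s)%N = false by lia.
Qed.

(** Describing the entries by one function f of the column, which vanishes on the
    padding, makes the two parts of the padded matrix uniform. *)
Lemma padr_mxE m r s (C : 'M[R]_(r, s)) k (a : 'I_m) (f : nat -> R) :
    (s <= m)%N -> (forall l : 'I_s, C k l = f l) ->
    (forall l, (s <= l)%N -> f l = 0) ->
  padr_mx m C k a = f a.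
Proof.
move=> le_sm fC f0; rewrite /padr_mx /conform_mx.
case: eqP => // e1; case: eqP => [e2|]; last by rewrite subnKC.
rewrite castmxE mxE cast_ord_id; case: splitP => l /= al; first by rewrite fC -al.
by rewrite mxE f0 // al leq_addr.
Qed.

Lemma padl_mxE m r s (C : 'M[R]_(r, s)) k (a : 'I_m) (f : nat -> R) :
    (s <= m)%N -> (forall l : 'I_s, C k l = f (m - s + l)%N) ->
    (forall l, (l < m - s)%N -> f l = 0) ->
  padl_mx m C k a = f a.
Proof.
move=> le_sm fC f0; rewrite /padl_mx /conform_mx.
case: eqP => // e1; case: eqP => [e2|]; last by rewrite subnK.
rewrite castmxE mxE cast_ord_id; case: splitP => l /= al; last by rewrite fC -al.
by rewrite mxE f0 // al ltn_ord.
Qed.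

Lemma padr_Cmx m s r (k : 'I_r) (a : 'I_m) :
  (s <= m)%N -> padr_mx m (Cmx R s r) k a = stencil R s k (r + a).
Proof.
move=> le_sm; apply: (@padr_mxE m r s _ k a (fun l => stencil R s k (r + l))) => // l.
  exact: Cmx_stencil.
by move=> le_sl; apply: stencil_far; have := ltn_ord k; lia.
Qed.

Lemma sum_Cmx m s r (k : 'I_r) (f : nat -> R) : (s <= m)%N ->
  \sum_(a < m) stencil R s k (r + a) * f a = \sum_(l < s) Cmx R s r k l * f l.
Proof.
move=> le_sm; under [RHS]eq_bigr => l _ do rewrite Cmx_stencil.
rewrite [RHS](big_ord_widen m (fun l => stencil R s k (r + l) * f l)) //.
rewrite [RHS]big_mkcond /=; apply: eq_bigr => a _; case: ltnP => // le_sa.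
by rewrite stencil_far ?mul0r //; have := ltn_ord k; lia.
Qed.

(** The rows of P *m D through which exactness enters: the lower blocks L and Z
    are arbitrary. *)
Lemma top_row_sum m s r (B : 'M[R]_r) (L : 'M[R]_(m + r, r))
    (Z : 'M[R]_(m + r)) (k : 'I_r) (f : nat -> R) : (s <= m)%N ->
  \sum_j block_mx B (row_mx (padr_mx m (Cmx R s r)) 0) L Z (lshift _ k) j * f j =
  \sum_(j < r) B k j * f j + \sum_(l < s) Cmx R s r k l * f (r + l)%N.
Proof.
move=> le_sm; rewrite !big_split_ord /=; congr (_ + _).
  by apply: eq_bigr => j _; rewrite block_mxEul.
rewrite [X in _ + X]big1 => [|j _]; last first.
  by rewrite block_mxEur row_mxEr mxE mul0r.
rewrite addr0 -(sum_Cmx k (fun l => f (r + l)%N) le_sm).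
by apply: eq_bigr => l _; rewrite block_mxEur row_mxEl padr_Cmx.
Qed.

(** The block coupling the last s interior points to the last r points. It is
    written for s interior points; by translation invariance of the stencil
    it is the same for any larger number. *)
Definition lower_mx s r : 'M[R]_(r, s) := \matrix_(k, l) stencil R s (s + k) l.

Lemma padl_lower_mx m s r (k : 'I_r) (a : 'I_m) :
  (s <= m)%N -> padl_mx m (lower_mx s r) k a = stencil R s (m + k) a.
Proof.
move=> le_sm; apply: (@padl_mxE m r s _ k a (fun l => stencil R s (m + k) l)) => // l.
  by rewrite mxE; apply: stencil_diff; lia.
by move=> lt_l; apply: stencil_far; lia.
Qed.

(** * Exactness at the other end by reflection *)

Lemma closure_exact_poly s t r B w (k : 'I_r) (p : {poly R}) :
    closure_exact s t B w -> (size p <= t.+1)%N ->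
  \sum_(j < r) B k j * p.[j%:R] + \sum_(l < s) Cmx R s r k l * p.[(r + l)%:R]
    = w k * p^`().[k%:R].
Proof.
move=> exB szp.
have coefs n (c : 'I_n -> R) (x : 'I_n -> R) : \sum_(j < n) c j * p.[x j] =
    \sum_(i < size p) p`_i * \sum_(j < n) c j * x j ^+ i.
  under eq_bigr => j _ do rewrite horner_coef mulr_sumr.
  rewrite exchange_big /=; apply: eq_bigr => i _; rewrite mulr_sumr.
  by apply: eq_bigr => j _; rewrite mulrCA.
rewrite !coefs -big_split /=.
rewrite -[in RHS](coefK p) poly_def raddf_sum horner_sum mulr_sumr /=.
apply: eq_bigr => i _; rewrite -mulrDr exB; last first.
  by rewrite -ltnS (leq_trans _ szp).
rewrite derivZ derivXn hornerZ hornerMn hornerXn -mulr_natl; ring.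
Qed.

Definition reflect_mx r (B : 'M[R]_r) : 'M[R]_r :=
  \matrix_(i, j) - B (rev_ord i) (rev_ord j).

(** The reflection x |-> N - x of the grid, N = 2 r + m - 1, takes the last rows
    to the first ones, where (N - x)^p is again a polynomial of degree p. Both
    the coefficients and the derivative change sign. *)
Lemma reflected_closure_exact m s t r (B : 'M[R]_r) w (k : 'I_r) p :
    (s <= m)%N -> closure_exact s t B w -> (p <= t)%N ->
  \sum_(a < m) stencil R s (m + k) a * (r + a)%:R ^+ p +
    \sum_(j < r) reflect_mx B k j * (r + (m + j))%:R ^+ p =
  w (rev_ord k) * (p%:R * (r + (m + k))%:R ^+ p.-1).
Proof.
move=> le_sm exB le_pt; pose N := (r + m + r.-1)%N.
pose f : {poly R} := (N%:R%:P - 'X) ^+ p.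
have szf : (size f <= t.+1)%N.
  rewrite (leq_trans (size_poly_exp_leq _ _)) //.
  rewrite -opprB size_polyN size_XsubC /=; lia.
have fE x y : (x + y = N)%N -> f.[x%:R] = y%:R ^+ p.
  move=> xy; rewrite /f -xy horner_exp !hornerE natrD; congr (_ ^+ _); ring.
have df : f^`().[(rev_ord k)%:R] = - (p%:R * (r + (m + k))%:R ^+ p.-1).
  rewrite deriv_exp derivB derivC derivX sub0r mulN1r hornerMn hornerN.
  rewrite horner_exp hornerD hornerN hornerC hornerX.
  have -> : N = (rev_ord k + (r + (m + k)))%N by have := ltn_ord k; rewrite /N /=; lia.
  by rewrite natrD [X in X - _]addrC addrK mulNrn mulr_natl.
have := closure_exact_poly (rev_ord k) exB szf; rewrite df mulrN => /eqP.
rewrite -eqr_oppLR => /eqP <-.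
rewrite -(sum_Cmx (rev_ord k) (fun l => f.[(r + l)%:R]) le_sm).
rewrite opprD addrC -!sumrN; congr (_ + _).
  rewrite (reindex_inj rev_ord_inj); apply: eq_bigr => j _.
  rewrite mxE rev_ordK -mulNr; congr (_ * _).
  by rewrite (fE j (r + (m + rev_ord j))%N) //; have := ltn_ord j; rewrite /N /=; lia.
rewrite (reindex_inj rev_ord_inj); apply: eq_bigr => a _; rewrite -mulNr.
rewrite (fE (r + a)%N (r + rev_ord a)%N); last first.
  by have := ltn_ord a; have := ltn_ord k; rewrite /N /=; lia.
rewrite -stencil_skew; congr (_ * _); apply: stencil_diff.
by have := ltn_ord a; have := ltn_ord k; rewrite /=; lia.
Qed.

(** * Diagonal norms and the boundary term *)

Lemma posdef_diag_mxP n (d : 'rV[R]_n) :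
  posdefmx (diag_mx d) <-> forall k, 0 < d 0 k.
Proof.
have quad (x : 'cV[R]_n) :
    (x^T *m diag_mx d *m x) 0 0 = \sum_k d 0 k * x k 0 ^+ 2.
  rewrite mul_mx_diag mxE; apply: eq_bigr => k _; rewrite !mxE; ring.
split=> [[_ pos] k | pos].
  have := pos (delta_mx k 0); rewrite quad (bigD1 k) //= big1 => [|j neq_jk].
    rewrite !mxE !eqxx expr1n mulr1 addr0; apply.
    by apply/eqP => /matrixP/(_ k 0); rewrite !mxE !eqxx => /eqP; rewrite oner_eq0.
  by rewrite mxE (negPf neq_jk) expr0n mulr0.
split=> [|x]; first exact: tr_diag_mx.
have nonneg k : 0 <= d 0 k * x k 0 ^+ 2.
  by rewrite mulr_ge0 ?sqr_ge0 // ltW.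
rewrite quad => x_neq0; rewrite lt_def sumr_ge0 // andbT.
apply: contra x_neq0 => /eqP /psumr_eq0P x0; apply/eqP/matrixP => k j.
rewrite ord1 mxE; apply/eqP; rewrite -sqrf_eq0.
have /eqP := x0 (fun k _ => nonneg k) k isT.
by rewrite mulf_eq0 (gt_eqF (pos k)).
Qed.

Lemma diag3_diag_mx r m (a b : 'rV[R]_r) :
  diag3_mx (diag_mx a) (1%:M : 'M_m) (diag_mx b) =
  diag_mx (row_mx a (row_mx (const_mx 1) b)).
Proof. by rewrite /diag3_mx -diag_const_mx !diag_mx_row. Qed.

Lemma diag3_mulV r m (A Z : 'M[R]_r) : A \in unitmx -> Z \in unitmx ->
  diag3_mx A (1%:M : 'M_m) Z *m diag3_mx (invmx A) 1%:M (invmx Z) = 1%:M.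
Proof.
move=> uA uZ; rewrite /diag3_mx !mulmx_block !(mulmx0, mul0mx, addr0, add0r).
by rewrite !mulmxV // mulmx1 -!scalar_mx_block.
Qed.

Lemma posdef_diag_unit n (d : 'rV[R]_n) : posdefmx (diag_mx d) -> diag_mx d \in unitmx.
Proof.
move=> /posdef_diag_mxP pos; rewrite unitmxE det_diag unitfE.
by apply/prodf_neq0 => k _; rewrite gt_eqF.
Qed.

Lemma evec_first r n : (0 < r)%N -> evec R (r + n) 0 = col_mx (evec R r 0) 0.
Proof.
move=> r_gt0; apply/matrixP => i j; rewrite !mxE.
by case: splitP => k ->; rewrite !mxE // addn_eq0 eqn0Ngt r_gt0.
Qed.

Lemma evec_last m r : (0 < r)%N ->
  evec R (m + r) (m + r).-1 = col_mx 0 (evec R r r.-1).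
Proof.
move=> r_gt0; apply/matrixP => i j; rewrite !mxE.
case: splitP => k ->; rewrite !mxE.
  by rewrite [_ == _](_ : _ = false) //; have := ltn_ord k; lia.
by congr (nat_of_bool _)%:R; lia.
Qed.

Lemma energy_blocks r m (n := (r + (m + r))%N) : (0 < r)%N ->
  evec R n n.-1 *m (evec R n n.-1)^T - evec R n 0 *m (evec R n 0)^T =
  block_mx (- (evec R r 0 *m (evec R r 0)^T)) 0 0
    (block_mx 0 0 0 (evec R r r.-1 *m (evec R r r.-1)^T)).
Proof.
move=> r_gt0; rewrite /n evec_first // evec_last ?addn_gt0 ?r_gt0 ?orbT //.
rewrite evec_last // !tr_col_mx !mul_col_row !trmx0 !(mulmx0, mul0mx).
by rewrite opp_block_mx add_block_mx !(oppr0, addr0, add0r).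
Qed.

(** * From operators to boundary blocks and back *)

Lemma sbp_closure m s t r (a b : 'rV[R]_r) P D :
    (0 < r)%N -> (s <= m)%N ->
    @sbp_operator R s t r m (diag_mx a) (diag_mx b) P D ->
  exists2 B : 'M[R]_r, B + B^T = - (evec R r 0 *m (evec R r 0)^T) &
    closure_exact s t B (a 0).
Proof.
move=> r_gt0 le_sm [pa pb eP _ acc energy [B [Bh [Dt [Ch /=]]]]].
set M := block_mx B _ _ _ => eD.
have PD : P *m D = M.
  by rewrite eD eP mulmxA diag3_mulV ?mul1mx //; apply: posdef_diag_unit.
have symP : P^T = P by rewrite eP diag3_diag_mx tr_diag_mx.
exists B.
  have := energy; rewrite /= energy_blocks // PD -{1}symP -trmx_mul PD.
  by rewrite tr_block_mx add_block_mx => /eq_block_mx[].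
move=> k p le_pt.
have := acc (lshift _ k) p; rewrite /= ltn_ord le_pt => /(_ isT isT).
move/(congr1 ( *%R (a 0 k))) <-; rewrite mulr_sumr.
have MD j : M (lshift _ k) j = a 0 k * D (lshift _ k) j.
  by rewrite -PD eP diag3_diag_mx mul_diag_mx mxE row_mxEl.
under [RHS]eq_bigr => j _ do rewrite mulrA -MD.
by rewrite (top_row_sum _ _ _ k (fun j => j%:R ^+ p) le_sm).
Qed.

(** The boundary block does not involve m, so a single solution of the quadrature
    conditions serves all grid sizes. *)
Lemma closure_sbp m s t r (a : 'rV[R]_r) (B : 'M[R]_r) :
    (0 < r)%N -> (s <= m)%N -> posdefmx (diag_mx a) ->
    B + B^T = - (evec R r 0 *m (evec R r 0)^T) ->
    closure_exact s t B (a 0) ->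
  exists (Ph : 'M[R]_r) P D,
    is_diag_mx Ph /\ @sbp_operator R s t r m (diag_mx a) Ph P D.
Proof.
move=> r_gt0 le_sm pa symB exB.
have a_gt0 := (posdef_diag_mxP a).1 pa.
pose b : 'rV[R]_r := \row_k a 0 (rev_ord k).
have pb : posdefmx (diag_mx b).
  by apply/posdef_diag_mxP => k; rewrite mxE.
have b_gt0 := (posdef_diag_mxP b).1 pb.
pose C0 := padr_mx m (Cmx R s r); pose Ch0 := padl_mx m (lower_mx s r).
pose Dt : 'M[R]_m := \matrix_(i, j) stencil R s i j.
pose M : 'M[R]_(r + (m + r)) := block_mx B (row_mx C0 0) (col_mx (- C0^T) 0)
  (block_mx Dt (- Ch0^T) Ch0 (reflect_mx B)).
pose P := diag3_mx (diag_mx a) (1%:M : 'M_m) (diag_mx b).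
(* D is kept opaque: all its properties are read off from P *m D = M, row by
   row. *)
have [D eD] : exists D,
    D = diag3_mx (invmx (diag_mx a)) 1%:M (invmx (diag_mx b)) *m M.
  by eexists.
have PD : P *m D = M.
  by rewrite eD mulmxA diag3_mulV ?mul1mx //; apply: posdef_diag_unit.
have MD i j : M i j = row_mx a (row_mx (const_mx 1) b) 0 i * D i j.
  by rewrite -PD /P diag3_diag_mx mul_diag_mx mxE.
exists (diag_mx b), P, D; split; first exact: diag_mx_is_diag.
split=> //.
- move=> i j; case: (split_ordP i) => i' -> /=.
    by have := ltn_ord i'; lia.
  case: (split_ordP i') => k -> /= => [_|]; last by have := ltn_ord k; lia.
  have -> : D (rshift r (lshift r k)) j = M (rshift r (lshift r k)) j.
    by rewrite MD row_mxEr row_mxEl mxE mul1r.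
  rewrite /M; case: (split_ordP j) => j' ->.
    rewrite block_mxEdl col_mxEu 2!mxE padr_Cmx // -stencil_skew.
    exact: stencil_diff.
  rewrite block_mxEdr; case: (split_ordP j') => l ->.
    by rewrite block_mxEul mxE; apply: stencil_diff => /=; lia.
  rewrite block_mxEur 2!mxE padl_lower_mx // -stencil_skew.
  by apply: stencil_diff => /=; lia.
- move=> i p; case: (split_ordP i) => k ->.
    move=> _ le_pt; apply: (mulfI (_ : a 0 k != 0)); first by rewrite gt_eqF.
    rewrite -exB // mulr_sumr /=.
    under eq_bigr => j _.
      have -> : a 0 k * (D (lshift (m + r) k) j * j%:R ^+ p) =
          M (lshift (m + r) k) j * j%:R ^+ p by rewrite MD row_mxEl mulrA.
      over.
    by rewrite (top_row_sum _ _ _ k (fun j => j%:R ^+ p) le_sm).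
  case: (split_ordP k) => l -> /=; first by have := ltn_ord l; lia.
  move=> _ le_pt; apply: (mulfI (_ : b 0 l != 0)); first by rewrite gt_eqF.
  rewrite [b 0 l in RHS]mxE -(reflected_closure_exact _ le_sm exB) //.
  rewrite mulr_sumr /=.
  under eq_bigr => j _.
    have -> : b 0 l * (D (rshift r (rshift m l)) j * j%:R ^+ p) =
        M (rshift r (rshift m l)) j * j%:R ^+ p by rewrite MD !row_mxEr mulrA.
    over.
  rewrite !big_split_ord /= big1 => [|j _]; last first.
    by rewrite block_mxEdl col_mxEd mxE mul0r.
  rewrite add0r; congr (_ + _); apply: eq_bigr => j _.
    by rewrite block_mxEdr block_mxEdl padl_lower_mx.
  by rewrite block_mxEdr block_mxEdr.
- rewrite /= energy_blocks // PD.
  have -> : D^T *m P = M^T by rewrite -PD trmx_mul /P diag3_diag_mx tr_diag_mx.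
  rewrite /M !tr_block_mx !add_block_mx symB.
  rewrite tr_row_mx tr_col_mx linearN /= trmxK !trmx0 add_row_mx add_col_mx.
  rewrite subrr addNr addr0 row_mx0 col_mx0; congr (block_mx _ 0 0 _).
  rewrite linearN /= trmxK subrr addNr; congr (block_mx _ 0 0 _).
    by apply/matrixP => i j; rewrite !mxE stencil_skew addNr.
  (* The lower corner of M + M^T is the reflection of - (B + B^T), and the
     reflection of e_0 is the last basis vector. *)
  apply/matrixP => i j; have /matrixP/(_ (rev_ord i) (rev_ord j)) := symB.
  rewrite !mxE !big_ord1 !mxE -opprD => ->; rewrite opprK.
  by congr (_%:R * _%:R); congr nat_of_bool; have := ltn_ord i; have := ltn_ord j; rewrite /=; lia.
by rewrite eD; exists B, (reflect_mx B), Dt, (lower_mx s r).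
Qed.

End SBP.

Theorem theorem2 (R : realType) (s t r : nat)
    (hs : (0 < s)%N) (ht : (0 < t)%N) (hr : (0 < r)%N) (hsr : (s <= r)%N) :
  diagonal_sbp_exists R s t r <->
  exists Pt : 'M[R]_r,
    [/\ is_diag_mx Pt, posdefmx Pt &
      forall p q : nat, (p <= t)%N -> (p <= q <= t)%N ->
        \sum_(k < r) (p + q)%:R * k%:R ^+ (p + q).-1 * Pt k k =
        \sum_(k < r) \sum_(l < s)
            (k%:R ^+ p * (r + l)%:R ^+ q + k%:R ^+ q * (r + l)%:R ^+ p)
            * Cmx R s r k l
        - (p == 0%N)%:R * (q == 0%N)%:R].
Proof.
split=> [sbp | [Pt [/diag_mxP[a ->] pa quad]] n le_n].
- have [] := sbp (2 * r + s)%N (leqnn _).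
  move=> Pt [Ph [P [D [/diag_mxP[a ->] /diag_mxP[b ->] op]]]].
  exists (diag_mx a); split; first exact: diag_mx_is_diag.
    exact: sbp_Pt_posdef op.
  have le_sm : (s <= 2 * r + s - 2 * r)%N by rewrite addKn.
  have [B symB exB] := sbp_closure hr le_sm op.
  move=> p q le_pt le_pq.
  under eq_bigr => k _ do rewrite mxE eqxx mulr1n.
  move: p q le_pt le_pq; apply: (quadrature_conditionsP s t (a 0) hr).2.
  by exists B.
have /(quadrature_conditionsP s t (a 0) hr)[B symB exB] :
    quadrature_conditions s t (a 0).
  move=> p q le_pt le_pq; rewrite -quad //.
  by apply: eq_bigr => k _; rewrite mxE eqxx mulr1n.
have le_sm : (s <= n - 2 * r)%N by rewrite leq_subRL // (leq_trans (leq_addr _ _) le_n).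
have [Ph [P [D [diagPh op]]]] := closure_sbp hr le_sm pa symB exB.
by exists (diag_mx a), Ph, P, D; split=> //; apply: diag_mx_is_diag.
Qed.
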